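(* Let $\mathcal{F}$ be an $f$-triangle of size $d\in\mathbb{N}\cup\{\infty\}$ and $n \in \{0,1,\dots,d\}$. (a) $h_{\mathcal{F}}(\Delta,x) = \mathcal{D}_{\mathcal{F},n}(h(\Delta,x))$ for every $(n-1)$-dimensional simplicial complex $\Delta$. (b) We have $\mathcal{D}_{\mathcal{F},n} = \mathcal{J}_n^{-1} \circ \mathcal{E}_{\mathcal{F},n} \circ \mathcal{J}_n$, where $\mathcal{J}_n: \mathbb{R}_n[x] \to \mathbb{R}_n[x]$ is the invertible linear operator which maps a polynomial $h(x) \in \mathbb{R}_n[x]$ to the associated $f$-polynomial and $\mathcal{E}_{\mathcal{F},n}$ is the restriction of $\mathcal{E}_{\mathcal{F}}$ to $\mathbb{R}_n[x]$. (c) The polynomial $p_{\mathcal{F},n,k}(x)$ is equal to the $h$-polynomial associated to $f_{\mathcal{F},n,k}(x) := \mathcal{E}_{\mathcal{F}}(x^k(1+x)^{n-k})$, so that $$p_{\mathcal{F},n,k}(x) \ = \ (1-x)^n f_{\mathcal{F},n,k}\left(\frac{x}{1-x}\right),$$ for every $k \in \{0,1,\dots,n\}$.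
   Context: Conventions: $\mathbb{N} = \{0,1,2,\dots\}$; $\{0,1,\dots,d\} := \mathbb{N}$ when $d=\infty$; $n,k,i,j$ are finite; $\mathbb{R}_d[x]$ is the space of real polynomials of degree at most $d$ (all of $\mathbb{R}[x]$ if $d=\infty$); $\binom{a}{b}:=0$ unless $0\le b\le a$. All simplicial complexes are finite abstract simplicial complexes (containing the empty face, of dimension $-1$). For an $(n-1)$-dimensional simplicial complex $\Delta$, let $f_{i}(\Delta)$ be the number of $i$-dimensional faces, $f(\Delta,x) = \sum_{i=0}^n f_{i-1}(\Delta)x^i$, and $h(\Delta,x) = (1-x)^n f(\Delta, \frac{x}{1-x}) =: \sum_{i=0}^n h_i(\Delta)x^i$. The $h$-polynomial associated to $f(x)\in\mathbb{R}_n[x]$ (with respect to $n$) is $(1-x)^nf(\frac{x}{1-x})$; the $f$-polynomial associated to $h(x)\in\mathbb{R}_n[x]$ (with respect to $n$) is $(1+x)^nh(\frac{x}{1+x})$. A simplicial complex $\Delta'$ is a triangulation of $\Delta$ if there are geometric realizations $K'$ and $K$ of $\Delta'$ and $\Delta$ such that $K'$ geometrically subdivides $K$. For $F \in \Delta$, the restriction of $\Delta'$ to $F$ is the subcomplex of $\Delta'$ corresponding to the triangulation which $K'$ induces on the simplex of $K$ corresponding to $F$. An $f$-triangle of size $d$ is a triangular array $\mathcal{F} = (f_{\mathcal{F}}(i,j))_{0 \le i \le j \le d}$ of nonnegative integers. Given a simplicial complex $\Delta$ of dimension less than $d$, a triangulation $\Delta'$ of $\Delta$ is $\mathcal{F}$-uniform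 if for all $0 \le i \le j \le d$, the restriction of $\Delta'$ to any $(j-1)$-dimensional face of $\Delta$ has exactly $f_{\mathcal{F}}(i,j)$ faces of dimension $i-1$. Let $\sigma_n$ denote the $(n-1)$-dimensional simplex. Put $f_{\mathcal{F}}(\sigma_n,x) = \sum_{i=0}^n f_{\mathcal{F}}(i,n)x^i$, $h_{\mathcal{F}}(\sigma_n,x) = (1-x)^n f_{\mathcal{F}}(\sigma_n,\frac{x}{1-x})$, $h^\circ_{\mathcal{F}}(\sigma_n,x)=x^nh_{\mathcal{F}}(\sigma_n,\frac1x)$ and $f^\circ_{\mathcal{F}}(\sigma_n,x)=(1+x)^nh^\circ_{\mathcal{F}}(\sigma_n,\frac{x}{1+x})$. (If $\mathcal{F}$-uniform triangulations of $\sigma_n$ exist, the coefficient of $x^i$ in $f^\circ_{\mathcal{F}}(\sigma_n,x)$ is the number of interior $(i-1)$-dimensional faces of any such triangulation.) For $0\le k\le n\le d$ let $$p_{\mathcal{F},n,k}(x) = \sum_{m=k}^n \binom{n-k}{m-k} x^m (1-x)^{n-m}\, h_{\mathcal{F}}(\sigma_m,1/x).$$ For an $(n-1)$-dimensional simplicial complex $\Delta$, let $h_{\mathcal{F}}(\Delta,x) := \sum_{k=0}^n h_k(\Delta)p_{\mathcal{F},n,k}(x)$; this is equal to the $h$-polynomial of any $\mathcal{F}$-uniform triangulation of $\Delta$. The $\mathcal{F}$-subdivision operator $\mathcal{E}_{\mathcal{F}}:\mathbb{R}_d[x]\to\mathbb{R}_d[x]$ is the linear operator with $\mathcal{E}_{\mathcal{F}}(x^n)=f^\circ_{\mathcal{F}}(\sigma_n,x)$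 for all $n\in\{0,1,\dots,d\}$. The linear operator $\mathcal{D}_{\mathcal{F},n}:\mathbb{R}_n[x]\to\mathbb{R}_n[x]$ is defined by $\mathcal{D}_{\mathcal{F},n}(x^k)=p_{\mathcal{F},n,k}(x)$ for every $k\in\{0,1,\dots,n\}$. *)

(* Defs.v *)
From HB Require Import structures.
From mathcomp Require Import all_boot all_order all_algebra.
From mathcomp Require Import reals.

Set Implicit Arguments.
Unset Strict Implicit.
Unset Printing Implicit Defensive.

Import GRing.Theory.
Local Open Scope ring_scope.

(* The value p(z) in R(x) of a polynomial p at a rational function z. *)
Definition rateval (R : fieldType) (p : {poly R}) (z : {fraction {poly R}}) :
  {fraction {poly R}} := (map_poly (fun c => tofrac c%:P) p).[z].

(* The polynomial v^n p(u/v), for p of degree at most n: see homogE. *)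
Definition homog (R : fieldType) (n : nat) (p u v : {poly R}) : {poly R} :=
  \sum_(i < n.+1) p`_i *: (u ^+ i * v ^+ (n - i)).

(* (1-x)^n f(x/(1-x)), (1+x)^n h(x/(1+x)) and x^n h(1/x). *)
Definition hpoly (R : fieldType) (n : nat) (f : {poly R}) : {poly R} :=
  homog n f 'X (1 - 'X).
Definition fpoly (R : fieldType) (n : nat) (h : {poly R}) : {poly R} :=
  homog n h 'X (1 + 'X).
Definition recip (R : fieldType) (n : nat) (h : {poly R}) : {poly R} :=
  homog n h 1 'X.

Lemma homogE (R : fieldType) (n : nat) (p u v : {poly R}) :
  (size p <= n.+1)%N -> v != 0 ->
  tofrac (homog n p u v) = tofrac v ^+ n * rateval p (tofrac u / tofrac v).
Proof.
move=> sp v0; have tv0 : tofrac v != 0 by rewrite tofrac_eq0.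
have -> : rateval p (tofrac u / tofrac v) =
  \sum_(i < n.+1) tofrac (p`_i)%:P * (tofrac u / tofrac v) ^+ i.
  rewrite /rateval (horner_coef_wide (n := n.+1)); last first.
    exact: leq_trans (size_poly _ _) sp.
  by apply: eq_bigr => i _; rewrite coef_map_id0.
rewrite /homog rmorph_sum mulr_sumr; apply: eq_bigr => i _ /=.
rewrite -mul_polyC !rmorphM !rmorphXn /= [RHS]mulrCA; congr (_ * _).
rewrite expr_div_n [RHS]mulrCA; congr (_ * _).
have le_in : (i <= n)%N by rewrite -ltnS.
by apply: (canRL (mulfK _)); rewrite ?expf_neq0 // -exprD subnK.
Qed.

Lemma size_homog (R : fieldType) (n : nat) (p u v : {poly R}) :
  (size u <= 2)%N -> (size v <= 2)%N -> (size (homog n p u v) <= n.+1)%N.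
Proof.
have szX (w : {poly R}) k : (size w <= 2)%N -> (size (w ^+ k) <= k.+1)%N.
  move=> sw; apply: leq_trans (size_poly_exp_leq _ _) _.
  by rewrite ltnS -[leqRHS]mul1n leq_mul2r -subn1 leq_subLR sw orbT.
move=> su sv; apply: (leq_trans (size_sum _ _ _)); apply/bigmax_leqP => i _.
apply: leq_trans (size_scale_leq _ _) _.
apply: leq_trans (size_polyMleq _ _) _.
have le_in : (i <= n)%N by rewrite -ltnS.
have := leq_add (szX _ i su) (szX _ (n - i)%N sv).
by rewrite addSn addnS subnKC // => h; rewrite -subn1 leq_subLR add1n.
Qed.

Lemma size_onesubX (R : fieldType) : (size (1 - 'X : {poly R})%R <= 2)%N.
Proof. by rewrite -opprB size_polyN size_XsubC. Qed.

Lemma size_oneaddX (R : fieldType) : (size (1 + 'X : {poly R})%R <= 2)%N.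
Proof. by rewrite addrC size_XaddC. Qed.

Lemma size_hpoly (R : fieldType) (n : nat) (f : {poly R}) :
  (size (hpoly n f) <= n.+1)%N.
Proof. by apply: size_homog; rewrite ?size_polyX ?size_onesubX. Qed.

Lemma size_fpoly (R : fieldType) (n : nat) (h : {poly R}) :
  (size (fpoly n h) <= n.+1)%N.
Proof. by apply: size_homog; rewrite ?size_polyX ?size_oneaddX. Qed.

Lemma size_recip (R : fieldType) (n : nat) (h : {poly R}) :
  (size (recip n h) <= n.+1)%N.
Proof. by apply: size_homog; rewrite ?size_polyX ?size_poly1. Qed.

Lemma fpoly_linear (R : fieldType) (n : nat) : linear (@fpoly R n).
Proof.
move=> a p q; rewrite /fpoly /homog scaler_sumr -big_split /=.
by apply: eq_bigr => i _; rewrite coefD coefZ scalerDl scalerA.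
Qed.

(* Elements of N \cup {infinity}; None stands for infinity. *)
Definition leq_inf (n : nat) (d : option nat) : bool :=
  if d is Some m then (n <= m)%N else true.

(* Triangular arrays indexed by 0 <= i <= j <= d, extended by 0. *)
Record ftriangle (d : option nat) := FTriangle {
  ft_entry :> nat -> nat -> nat;
  ft_out : forall i j, ~~ ((i <= j)%N && leq_inf j d) -> ft_entry i j = 0%N
}.

(* f, h, h° and f° of the simplex sigma_n. *)
Definition f_simplex (R : fieldType) d (F : ftriangle d) (n : nat) : {poly R} :=
  \sum_(i < n.+1) (F i n)%:R *: 'X^i.
Definition h_simplex (R : fieldType) d (F : ftriangle d) (n : nat) : {poly R} :=
  hpoly n (f_simplex R F n).
Definition h_int (R : fieldType) d (F : ftriangle d) (n : nat) : {poly R} :=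
  recip n (h_simplex R F n).
Definition f_int (R : fieldType) d (F : ftriangle d) (n : nat) : {poly R} :=
  fpoly n (h_int R F n).

Definition p_poly (R : fieldType) d (F : ftriangle d) (n k : nat) : {poly R} :=
  \sum_(k <= m < n.+1)
    'C(n - k, m - k)%:R *: ((1 - 'X) ^+ (n - m) * recip m (h_simplex R F m)).

Lemma size_p_poly (R : fieldType) d (F : ftriangle d) (n k : nat) :
  (size (p_poly R F n k) <= n.+1)%N.
Proof.
rewrite /p_poly big_seq_cond; apply: (leq_trans (size_sum _ _ _)).
apply/bigmax_leqP_seq => m _; rewrite andbT mem_index_iota ltnS => /andP[_ lemn].
apply: leq_trans (size_scale_leq _ _) _.
apply: leq_trans (size_polyMleq _ _) _.
rewrite -subn1 leq_subLR add1n.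
have sw : (size ((1 - 'X : {poly R}) ^+ (n - m))%R <= (n - m).+1)%N.
  apply: leq_trans (size_poly_exp_leq _ _) _.
  have := size_onesubX R; case: (size _) => [|[|[|//]]] _ /=;
  by rewrite ?mul0n ?mul1n.
have := leq_add sw (size_recip m (h_simplex R F m)).
by rewrite addSn addnS subnK.
Qed.

(* If d is finite, subdiv_op vanishes on x^n for n > d (see subdiv_opXn_out), *)
(* so that it is the extension by 0 of an operator on polynomials of degree   *)
(* at most d.                                                                 *)
Definition subdiv_op (R : fieldType) d (F : ftriangle d) (p : {poly R}) :
  {poly R} := \sum_(i < size p) p`_i *: f_int R F i.

Lemma subdiv_op_wide (R : fieldType) d (F : ftriangle d) N (p : {poly R}) :
  (size p <= N)%N -> subdiv_op F p = \sum_(i < N) p`_i *: f_int R F i.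
Proof.
move=> spN; rewrite /subdiv_op (big_ord_widen _ (fun i => p`_i *: f_int R F i) spN).
rewrite big_mkcond; apply: eq_bigr => i _; case: ifP => // /negbT.
by rewrite -leqNgt => le_pi; rewrite nth_default // scale0r.
Qed.

Lemma subdiv_op_linear (R : fieldType) d (F : ftriangle d) :
  linear (@subdiv_op R d F).
Proof.
move=> a p q; pose N := maxn (size (a *: p + q)) (maxn (size p) (size q)).
rewrite !(@subdiv_op_wide _ _ _ N) ?leq_max ?leqnn ?orbT //.
rewrite scaler_sumr -big_split /=.
by apply: eq_bigr => i _; rewrite coefD coefZ scalerDl scalerA.
Qed.

HB.instance Definition _ (R : fieldType) d (F : ftriangle d) :=
  GRing.isLinear.Build R {poly R} {poly R} _ (@subdiv_op R d F)
    (subdiv_op_linear F).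

Lemma subdiv_opXn (R : fieldType) d (F : ftriangle d) n :
  subdiv_op F 'X^n = f_int R F n.
Proof.
rewrite /subdiv_op size_polyXn (bigD1 ord_max) //= big1 => [|i].
  by rewrite coefXn eqxx scale1r addr0.
by rewrite -val_eqE /= coefXn => /negPf->; rewrite scale0r.
Qed.

Lemma subdiv_opXn_out (R : fieldType) d (F : ftriangle d) n :
  ~~ leq_inf n d -> subdiv_op F ('X^n : {poly R}) = 0.
Proof.
move=> ltdn; rewrite subdiv_opXn /f_int /h_int /h_simplex.
have -> : f_simplex R F n = 0.
  apply: big1 => i _; rewrite ft_out ?scale0r //.
  by rewrite negb_and ltdn orbT.
have h0 m (u v : {poly R}) : homog m 0 u v = 0.
  by apply: big1 => i _; rewrite coef0 scale0r.
by rewrite /hpoly h0 /recip h0 /fpoly h0.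
Qed.

Lemma size_subdiv_op (R : fieldType) d (F : ftriangle d) (p : {poly R}) :
  (size (subdiv_op F p) <= size p)%N.
Proof.
apply: (leq_trans (size_sum _ _ _)); apply/bigmax_leqP => i _.
apply: leq_trans (size_scale_leq _ _) _.
exact: leq_trans (size_fpoly _ _) (ltn_ord i).
Qed.

(* The operators J_n, E_{F,n} and D_{F,n} on R_n[x] = {poly_n.+1 R}. *)
Definition J_op (R : fieldType) (n : nat) (h : {poly_n.+1 R}) : {poly_n.+1 R} :=
  NPoly (size_fpoly n h).

Fact J_op_linear (R : fieldType) (n : nat) : linear (@J_op R n).
Proof. by move=> a p q; apply: val_inj; exact: fpoly_linear. Qed.

HB.instance Definition _ (R : fieldType) (n : nat) :=
  GRing.isLinear.Build R {poly_n.+1 R} {poly_n.+1 R} _ (@J_op R n)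
    (@J_op_linear R n).

Definition E_op (R : fieldType) d (F : ftriangle d) (n : nat)
    (p : {poly_n.+1 R}) : {poly_n.+1 R} :=
  NPoly (leq_trans (size_subdiv_op F p) (size_npoly p)).

Fact E_op_linear (R : fieldType) d (F : ftriangle d) (n : nat) :
  linear (@E_op R d F n).
Proof. by move=> a p q; apply: val_inj; exact: subdiv_op_linear. Qed.

HB.instance Definition _ (R : fieldType) d (F : ftriangle d) (n : nat) :=
  GRing.isLinear.Build R {poly_n.+1 R} {poly_n.+1 R} _ (@E_op R d F n)
    (@E_op_linear R d F n).

Definition D_op (R : fieldType) d (F : ftriangle d) (n : nat)
    (p : {poly_n.+1 R}) : {poly_n.+1 R} :=
  \sum_(k < n.+1) p`_k *: NPoly (size_p_poly R F n k).

Fact D_op_linear (R : fieldType) d (F : ftriangle d) (n : nat) :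
  linear (@D_op R d F n).
Proof.
move=> a p q; rewrite /D_op scaler_sumr -big_split /=.
by apply: eq_bigr => i _; rewrite coefD coefZ scalerDl scalerA.
Qed.

HB.instance Definition _ (R : fieldType) d (F : ftriangle d) (n : nat) :=
  GRing.isLinear.Build R {poly_n.+1 R} {poly_n.+1 R} _ (@D_op R d F n)
    (@D_op_linear R d F n).

Lemma D_opXn (R : fieldType) d (F : ftriangle d) (n : nat) (k : 'I_n.+1) :
  D_op F (npolyp n.+1 'X^k) = p_poly R F n k :> {poly R}.
Proof.
rewrite /D_op (bigD1 k) //= big1 => [|i ne_ik].
  by rewrite addr0 coef_npolyp ltn_ord coefXn eqxx scale1r.
rewrite coef_npolyp ltn_ord coefXn.
by move: ne_ik; rewrite -val_eqE /= => /negPf->; rewrite scale0r.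
Qed.

(* Elements of V need not be vertices: [set v] may fail to be a face. *)
Record scomplex (V : finType) := SComplex {
  faces :> {set {set V}};
  faces0 : set0 \in faces;
  faces_sub : forall A B : {set V}, B \in faces -> A \subset B -> A \in faces
}.

Definition dim_face (V : finType) (A : {set V}) : int := #|A|%:Z - 1.

Definition dim_complex (V : finType) (Delta : scomplex V) : int :=
  (\max_(A in (Delta : {set {set V}})) #|A|)%:Z - 1.

Definition face_number (V : finType) (Delta : scomplex V) (i : int) : nat :=
  #|[set A in (Delta : {set {set V}}) | dim_face A == i]|.

(* In what follows n - 1 is the dimension of Delta. *)
Definition f_complex (R : fieldType) (V : finType) (n : nat)
    (Delta : scomplex V) : {poly R} :=
  \sum_(i < n.+1) (face_number Delta (i%:Z - 1))%:R *: 'X^i.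

Definition h_complex (R : fieldType) (V : finType) (n : nat)
    (Delta : scomplex V) : {poly_n.+1 R} :=
  NPoly (size_hpoly n (f_complex R n Delta)).

Definition hF_complex (R : fieldType) d (F : ftriangle d) (V : finType)
    (n : nat) (Delta : scomplex V) : {poly R} :=
  \sum_(k < n.+1) (h_complex R n Delta)`_k *: p_poly R F n k.

Definition f_poly (R : fieldType) d (F : ftriangle d) (n k : nat) : {poly R} :=
  subdiv_op F ('X^k * (1 + 'X) ^+ (n - k)).

(* Main.v *)
Require Import Defs.
From HB Require Import structures.
From mathcomp Require Import all_boot all_order all_algebra.
From mathcomp Require Import reals.

(** The passages between f-polynomials and h-polynomials are projective changes
    of variable: x/(1-x) and x/(1+x) are mutually inverse, and [homog_homog]
    keeps track of the factor left over when the two degrees differ.  Passing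
    to the f-polynomial with respect to m and then to the h-polynomial with
    respect to n >= m multiplies by (1-x)^(n-m).

    This explains the definition of p_{F,n,k}.  By the binomial theorem
    x^k (1+x)^(n-k) is the sum of C(n-k,m-k) x^m over k <= m <= n, and the
    subdivision operator sends x^m to the f-polynomial, with respect to m, of
    x^m h_F(sigma_m,1/x).  Its h-polynomial with respect to n is therefore
    (1-x)^(n-m) x^m h_F(sigma_m,1/x), which p_{F,n,k} sums over m with the same
    binomial coefficients; this is (c), in [p_polyE].

    The polynomial x^k (1+x)^(n-k) is also the image of x^k under J_n, and the
    inverse of J_n takes h-polynomials, so (c) is (b) evaluated on the
    monomials x^k, and (b) follows by linearity.  Part (a) is linearity of
    D_{F,n} alone. *)

Import GRing.Theory.
Local Open Scope ring_scope.

Lemma homog_sum (R : fieldType) (I : Type) (r : seq I) (P : pred I)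
    (a : I -> R) (p : I -> {poly R}) (n : nat) (u v : {poly R}) :
  homog n (\sum_(i <- r | P i) a i *: p i) u v =
  \sum_(i <- r | P i) a i *: homog n (p i) u v.
Proof.
rewrite /homog; under [RHS]eq_bigr do rewrite scaler_sumr.
rewrite exchange_big; apply: eq_bigr => j _ /=.
by rewrite coef_sum scaler_suml; apply: eq_bigr => i _; rewrite coefZ scalerA.
Qed.

Lemma homogXn (R : fieldType) (m i : nat) (u v : {poly R}) :
  (i <= m)%N -> homog m 'X^i u v = u ^+ i * v ^+ (m - i).
Proof.
rewrite -ltnS => lt_im; rewrite /homog (bigD1 (Ordinal lt_im)) //=.
rewrite coefXn eqxx scale1r big1 ?addr0 // => j.
by rewrite -val_eqE /= coefXn => /negPf ->; rewrite scale0r.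
Qed.

Lemma hpoly_linear (R : fieldType) (n : nat) : linear (@hpoly R n).
Proof.
move=> a p q; rewrite /hpoly /homog scaler_sumr -big_split /=.
by apply: eq_bigr => i _; rewrite coefD coefZ scalerDl scalerA.
Qed.

Lemma onesubcX_neq0 (R : fieldType) (c : R) : 1 - c *: 'X != 0 :> {poly R}.
Proof.
apply/eqP => /(congr1 (fun p : {poly R} => p`_0)) /eqP.
by rewrite coefB coefZ coefX coef1 coef0 mulr0 subr0 oner_eq0.
Qed.

Lemma size_linearX (R : fieldType) (c : R) :
  (size (1 + c *: 'X : {poly R})%R <= 2)%N.
Proof.
apply: leq_trans (size_polyD _ _) _; rewrite size_poly1 geq_max /=.
by apply: leq_trans (size_scale_leq _ _) _; rewrite size_polyX.
Qed.

Lemma rateval_monomial (R : fieldType) (c : R) (i j : nat)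
    (z : {fraction {poly R}}) :
  rateval ('X^i * (1 + c *: 'X) ^+ j) z = z ^+ i * (1 + tofrac c%:P * z) ^+ j.
Proof.
pose phi : {rmorphism R -> {fraction {poly R}}} := @tofrac _ \o @polyC R.
rewrite /rateval (_ : map_poly _ = map_poly phi) // !(rmorphM, rmorphXn, rmorphD, rmorph1) /=.
rewrite map_polyZ map_polyX /=.
by rewrite !(hornerM, horner_exp, hornerD, hornerC, hornerX, hornerZ).
Qed.

(** With z = x/(1-cx) one has 1 + cz = 1/(1-cx), so every factor x or 1 + cx
    of the degree m form on the left contributes one power of (1-cx)^-1. *)
Lemma homog_monomial (R : fieldType) (c : R) (i m n : nat) :
  (i <= m <= n)%N ->
  homog n ('X^i * (1 + c *: 'X) ^+ (m - i)) 'X (1 - c *: 'X) =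
  (1 - c *: 'X) ^+ (n - m) * 'X^i :> {poly R}.
Proof.
case/andP=> le_im le_mn; apply/eqP; rewrite -tofrac_eq; apply/eqP.
set v := 1 - c *: 'X; have v0 : v != 0 := onesubcX_neq0 R c.
have tv0 : tofrac v != 0 by rewrite tofrac_eq0.
rewrite homogE //; last first.
  rewrite -homogXn //; apply: leq_trans (_ : m.+1 <= n.+1)%N => //.
  by apply: size_homog; rewrite ?size_polyX ?size_linearX.
have zE : 1 + tofrac c%:P * (tofrac 'X / tofrac v) = (tofrac v)^-1.
  rewrite -[RHS]mul1r; apply: (canRL (mulfK tv0)).
  rewrite mulrDl mul1r mulrA mulfVK // -rmorphM -rmorphD /= mul_polyC.
  by rewrite /v subrK rmorph1.
have -> : rateval ('X^i * (1 + c *: 'X) ^+ (m - i)) (tofrac 'X / tofrac v) =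
    (tofrac 'X / tofrac v) ^+ i * (tofrac v)^-1 ^+ (m - i).
  by rewrite rateval_monomial zE.
rewrite rmorphM !rmorphXn expr_div_n -exprVn -mulrA -exprD subnKC //.
rewrite mulrCA [RHS]mulrC; congr (_ * _).
rewrite exprVn; apply: (canLR (mulfK _)); first by rewrite expf_neq0.
by rewrite -exprD subnK.
Qed.

(** The substitutions x/(1+cx) and x/(1-cx) are mutually inverse; c = 1 and
    c = -1 give the two composites of [hpoly] and [fpoly]. *)
Lemma homog_homog (R : fieldType) (c : R) (m n : nat) (p : {poly R}) :
  (m <= n)%N -> (size p <= m.+1)%N ->
  homog n (homog m p 'X (1 + c *: 'X)) 'X (1 - c *: 'X) =
  (1 - c *: 'X) ^+ (n - m) * p.
Proof.
move=> le_mn szp; rewrite {2}/homog homog_sum.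
rewrite [in RHS](_ : p = \sum_(i < m.+1) p`_i *: 'X^i); last first.
  rewrite -poly_def; apply/polyP => i; rewrite coef_poly.
  by case: ltnP => // /(leq_trans szp) le_pi; rewrite nth_default.
rewrite mulr_sumr; apply: eq_bigr => i _.
by rewrite homog_monomial ?le_mn ?andbT -1?ltnS // scalerAr.
Qed.

Lemma hpoly_fpoly (R : fieldType) (m n : nat) (h : {poly R}) :
  (m <= n)%N -> (size h <= m.+1)%N ->
  hpoly n (fpoly m h) = (1 - 'X) ^+ (n - m) * h.
Proof.
move=> le_mn szh.
by have := homog_homog R 1 m n h le_mn szh; rewrite scale1r.
Qed.

Lemma fpoly_hpoly (R : fieldType) (n : nat) (f : {poly R}) :
  (size f <= n.+1)%N -> fpoly n (hpoly n f) = f.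
Proof.
move=> szf; have := homog_homog R (-1) n n f (leqnn n) szf.
by rewrite scaleN1r opprK subnn expr0 mul1r.
Qed.

Lemma expand_Xk_oneaddX (R : fieldType) (n k : nat) :
  (k <= n)%N ->
  'X^k * (1 + 'X) ^+ (n - k) =
  \sum_(k <= m < n.+1) 'C(n - k, m - k)%:R *: 'X^m :> {poly R}.
Proof.
move=> le_kn; rewrite exprDn mulr_sumr (big_addn 0 n.+1 k) subSn // big_mkord.
apply: eq_bigr => i _.
by rewrite addnK expr1n mul1r mulrnAr -exprD addnC scaler_nat.
Qed.

Lemma p_polyE (R : fieldType) d (F : ftriangle d) (n k : nat) :
  (k <= n)%N -> p_poly R F n k = hpoly n (f_poly R F n k).
Proof.
move=> le_kn; rewrite /f_poly expand_Xk_oneaddX // linear_sum /=.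
under eq_bigr do rewrite linearZ /= subdiv_opXn.
rewrite /hpoly homog_sum; rewrite /p_poly !big_nat; apply: eq_bigr => m.
rewrite ltnS => /andP[_ le_mn]; congr (_ *: _).
by rewrite -/(hpoly n _) hpoly_fpoly ?size_recip.
Qed.

Lemma size_f_poly (R : fieldType) d (F : ftriangle d) (n k : nat) :
  (k <= n)%N -> (size (f_poly R F n k) <= n.+1)%N.
Proof.
move=> le_kn; apply: leq_trans (size_subdiv_op _ _) _.
rewrite expand_Xk_oneaddX // big_nat; apply: (leq_trans (size_sum _ _ _)).
apply/bigmax_leqP_seq => m _ /andP[_ lt_mn].
by apply: leq_trans (size_scale_leq _ _) _; rewrite size_polyXn.
Qed.

Lemma D_opE (R : fieldType) d (F : ftriangle d) (n : nat) (p : {poly_n.+1 R}) :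
  D_op F p = \sum_(k < n.+1) p`_k *: p_poly R F n k :> {poly R}.
Proof.
by rewrite /D_op; elim/big_rec2: _ => //= k q r _ <-.
Qed.

Definition J_inv (R : fieldType) (n : nat) (f : {poly_n.+1 R}) : {poly_n.+1 R} :=
  NPoly (size_hpoly n f).

Lemma J_inv_linear (R : fieldType) (n : nat) : linear (J_inv R n).
Proof. by move=> a p q; apply: val_inj; exact: hpoly_linear. Qed.

HB.instance Definition _ (R : fieldType) (n : nat) :=
  GRing.isLinear.Build R {poly_n.+1 R} {poly_n.+1 R} _ (J_inv R n)
    (J_inv_linear R n).

Lemma J_opK (R : fieldType) (n : nat) : cancel (@J_op R n) (J_inv R n).
Proof.
move=> p; apply: val_inj => /=.
by rewrite hpoly_fpoly ?size_npoly // subnn expr0 mul1r.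
Qed.

Lemma J_invK (R : fieldType) (n : nat) : cancel (J_inv R n) (@J_op R n).
Proof. by move=> p; apply: val_inj; rewrite /= fpoly_hpoly ?size_npoly. Qed.

(** The summands of J_n p are p_k x^k (1+x)^(n-k), on which the right-hand side
    is computed by [p_polyE]. *)
Lemma D_op_conj (R : fieldType) d (F : ftriangle d) (n : nat)
    (p : {poly_n.+1 R}) : D_op F p = J_inv R n (E_op F (J_op p)).
Proof.
apply: val_inj; rewrite [LHS]D_opE /= /fpoly {1}/homog linear_sum /=.
under [in RHS]eq_bigr do rewrite linearZ /=.
rewrite /hpoly homog_sum; apply: eq_bigr => k _.
by rewrite p_polyE // -ltnS.
Qed.

Theorem proposition5p5 (R : realType) (d : option nat) (F : ftriangle d)
    (n : nat) (le_nd : leq_inf n d) :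
  [/\ (* (a) *)
      forall (V : finType) (Delta : scomplex V),
        dim_complex Delta = n%:Z - 1 ->
        hF_complex R F n Delta = D_op F (h_complex R n Delta) :> {poly R},
      (* (b) *)
      exists Jinv : {linear {poly_n.+1 R} -> {poly_n.+1 R}},
        [/\ cancel (@J_op R n) Jinv, cancel Jinv (@J_op R n)
          & forall p : {poly_n.+1 R}, D_op F p = Jinv (E_op F (J_op p))]
    & (* (c) *)
      forall k : nat, (k <= n)%N ->
        p_poly R F n k = hpoly n (f_poly R F n k) /\
        tofrac (p_poly R F n k) =
          tofrac (1 - 'X) ^+ n *
          rateval (f_poly R F n k) (tofrac 'X / tofrac (1 - 'X))].
Proof.
split=> [V Delta _ | | k le_kn].
- by rewrite D_opE.
- exists (J_inv R n); split; [exact: J_opK | exact: J_invK | exact: D_op_conj].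
- split; first exact: p_polyE.
  rewrite p_polyE // /hpoly homogE ?size_f_poly //.
  by have := onesubcX_neq0 R 1; rewrite scale1r.
Qed.
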